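(* Over profiles whose ballots are strict weak orders (ties allowed): (i) the Split Cycle VCCR $sc$ satisfies Anonymity, Neutrality, Availability, Homogeneity, Downward Homogeneity, Neutral Indifference, Neutral Reversal, Monotonicity, Coherent IIA, Coherent Defeat, and Positive Involvement in Defeat; (ii) any VCCR $f$ satisfying Anonymity, Neutrality, Availability, Downward Homogeneity, Neutral Indifference, Neutral Reversal, Monotonicity for two-candidate profiles, Coherent IIA, Coherent Defeat, and Positive Involvement in Defeat equals $sc$; (iii) the same holds if Downward Homogeneity and Neutral Indifference in (ii) are replaced by Homogeneity.
   Context: Fix infinite sets $\mathcal V$ (voters) and $\mathcal X$ (candidates). For finite $X$, $\mathcal W(X)$ is the set of strict weak orders on $X$ (irreflexive, transitive and negatively transitive relations); $x,y$ are tied in $\succ$ if neither $x\succ y$ nor $y\succ x$; the empty relation (everything tied) is allowed. A profile is a function $\mathbf P:V\to\mathcal W(X)$ for nonempty finite $V\subset\mathcal V$, $X\subset\mathcal X$; $V(\mathbf P)=V$, $X(\mathbf P)=X$. ''Voter $i$ ranks $x$ above $y$'' means $(x,y)\in\mathbf P(i)$ (strictly). $\mathbf P_{|Y}$ restricts ballots to $Y$. $\mathrm{Margin}_{\mathbf P}(x,y)$ = number of voters ranking $x$ strictly above $y$ minus number ranking $y$ strictly above $x$; $x$ is majority preferred to $y$ if it is $>0$. The margin graph $\mathcal M(\mathbf P)$ has vertices $X(\mathbf P)$ and edges $x\to y$ with weight $\mathrm{Margin}_{\mathbf P}(x,y)$ when positive. A majority path from $x_1$ to $x_n$ is $(x_1,\dots,x_n)$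 with all $\mathrm{Margin}_{\mathbf P}(x_i,x_{i+1})>0$; its strength is the minimum of these margins. A VCCR is a function $f$ giving for each profile an asymmetric relation $f(\mathbf P)$ on $X(\mathbf P)$ (''$x$ defeats $y$'' iff $(x,y)\in f(\mathbf P)$). $sc$: $(x,y)\in sc(\mathbf P)$ iff $\mathrm{Margin}_{\mathbf P}(x,y)>0$ and it exceeds the strength of every majority path from $y$ to $x$. Moving up one place: given a strict weak order $\succ$ on finite $X$ and $x$ not $\succ$-greatest, let $x'\neq x$ be $\succ$-minimal among elements with $x\not\succ x'$. $\succ'$ results from moving $x$ up one place if $\succ'$ agrees with $\succ$ on pairs not involving $x$, and: if $x$ is tied with $x'$ in $\succ$, then in $\succ'$ $x$ is tied with no other element, $x\succ' x'$, and $y\succ x$ implies $y\succ' x$; if $x$ is tied with no other element in $\succ$, then $x$ is tied with $x'$ in $\succ'$. Axioms for a VCCR $f$: Anonymity (if $V(\mathbf P)=V(\mathbf P')$ and a bijection $\pi$ of voters has $\mathbf P'(i)=\mathbf P(\pi(i))$, then $f(\mathbf P)=f(\mathbf P')$); Neutrality (if same voters and candidates and a bijection $\pi$ of candidates has $(x,y)\in\mathbf P(i)\iff(\pi x,\pi y)\in\mathbf P'(i)$ for all $i,x,y$, then $(x,y)\in f(\mathbf P)\iff(\pi x,\pi y)\in f(\mathbf P')$); Availability (some candidate is defeated by no one in every $\mathbf P$); Homogeneity $f(\mathbf P)=f(2\mathbf P)$ and Downward Homogeneity $f(\mathbf P)\supseteq f(2\mathbf P)$, where $2\mathbf P$ replaces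 each voter by two copies; Neutral Indifference (adding a voter with the empty ballot leaves $f$ unchanged); Neutral Reversal (adding two voters with mutually converse ballots leaves $f$ unchanged); Monotonicity (resp. for two-candidate profiles): for every profile (resp. every two-candidate profile), if $\mathbf P'$ arises by moving $x$ up one place in one voter's ballot, $(x,y)\in f(\mathbf P)$ implies $(x,y)\in f(\mathbf P')$; Coherent IIA: with $\mathbf P\rightsquigarrow_{x,y}\mathbf P'$ meaning $\mathbf P_{|\{x,y\}}=\mathbf P'_{|\{x,y\}}$ and $\mathcal M(\mathbf P')$ obtainable from $\mathcal M(\mathbf P)$ by deleting zero or more candidates other than $x,y$ and deleting or reducing weights of zero or more edges not connecting $x,y$, if $(x,y)\in f(\mathbf P)$ and $\mathbf P\rightsquigarrow_{x,y}\mathbf P'$ then $(x,y)\in f(\mathbf P')$; Coherent Defeat: if $\mathrm{Margin}_{\mathbf P}(x,y)>0$ and no majority path from $y$ to $x$ exists, then $(x,y)\in f(\mathbf P)$; Positive Involvement in Defeat: if $(x,y)\notin f(\mathbf P)$ and $\mathbf P'$ adds one new voter ranking $y$ strictly above $x$, then $(x,y)\notin f(\mathbf P')$. *)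

(* Defs.v *)
From mathcomp Require Import all_boot all_order all_algebra.
From mathcomp Require Import finmap.
Set Implicit Arguments. Unset Strict Implicit. Unset Printing Implicit Defensive.
Import Order.TTheory GRing.Theory Num.Theory.
Local Open Scope fset_scope.

Section Voting.
Variables (Vt Xt : choiceType).

(* A profile: finite voter set, finite candidate set, and a ballot
   (a relation: pB P i a b  <->  voter i ranks a strictly above b). *)
Record profile := Profile { pV : {fset Vt}; pX : {fset Xt}; pB : Vt -> rel Xt }.

Definition tied (R : rel Xt) (a b : Xt) : bool := ~~ R a b && ~~ R b a.

Definition strict_weak_order (X : {fset Xt}) (R : rel Xt) : Prop :=
  [/\ (forall a, a \in X -> ~~ R a a),
      (forall a b c, a \in X -> b \in X -> c \in X -> R a b -> R b c -> R a c) &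
      (forall a b c, a \in X -> b \in X -> c \in X ->
          ~~ R a b -> ~~ R b c -> ~~ R a c)].

(* Well-formed profile: V, X nonempty, every ballot of a voter in V is a strict
   weak order on X, and the data is canonical (ballots are empty outside V x X x X). *)
Definition wf_profile (P : profile) : Prop :=
  [/\ pV P != fset0, pX P != fset0,
      (forall i, i \in pV P -> strict_weak_order (pX P) (pB P i)) &
      (forall i a b, pB P i a b -> [/\ i \in pV P, a \in pX P & b \in pX P])].

Definition nvoters (P : profile) (a b : Xt) : nat :=
  #|` [fset i in pV P | pB P i a b] |.

Definition margin (P : profile) (a b : Xt) : int :=
  ((nvoters P a b)%:Z - (nvoters P b a)%:Z)%R.

Definition maj_path (P : profile) (a : Xt) (s : seq Xt) : bool :=
  (s != [::]) && path (fun u v => (0 < margin P u v)%R) a s.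

Fixpoint strength (P : profile) (a : Xt) (s : seq Xt) : int :=
  match s with
  | [::] => 0%R
  | b :: s' => if s' is [::] then margin P a b
               else Num.min (margin P a b) (strength P b s')
  end.

Definition vccr_fun := profile -> Xt -> Xt -> Prop.

Definition is_vccr (f : vccr_fun) : Prop :=
  forall P, wf_profile P ->
    (forall x y, f P x y -> x \in pX P /\ y \in pX P) /\
    (forall x y, f P x y -> ~ f P y x).

Definition sc : vccr_fun := fun P x y =>
  (0 < margin P x y)%R /\
  forall s, maj_path P y s -> last y s = x -> (strength P y s < margin P x y)%R.

Definition same_rel (r1 r2 : Xt -> Xt -> Prop) : Prop :=
  forall x y, r1 x y <-> r2 x y.

Definition anonymity (f : vccr_fun) : Prop :=
  forall (P P' : profile) (pi : Vt -> Vt),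
    wf_profile P -> wf_profile P' -> pV P' = pV P -> pX P' = pX P ->
    {in pV P, forall i, pi i \in pV P} -> {in pV P &, injective pi} ->
    (forall i, i \in pV P -> pB P' i =2 pB P (pi i)) ->
    same_rel (f P) (f P').

Definition neutrality (f : vccr_fun) : Prop :=
  forall (P P' : profile) (pi : Xt -> Xt),
    wf_profile P -> wf_profile P' -> pV P' = pV P -> pX P' = pX P ->
    {in pX P, forall x, pi x \in pX P} -> {in pX P &, injective pi} ->
    (forall i x y, i \in pV P -> x \in pX P -> y \in pX P ->
        pB P i x y = pB P' i (pi x) (pi y)) ->
    forall x y, x \in pX P -> y \in pX P -> (f P x y <-> f P' (pi x) (pi y)).

Definition availability (f : vccr_fun) : Prop :=
  forall P, wf_profile P -> exists x, x \in pX P /\ forall y, ~ f P y x.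

Definition doubled (P P' : profile) : Prop :=
  pX P' = pX P /\
  exists h : Vt -> Vt,
    (forall i, i \in pV P' -> h i \in pV P /\ pB P' i =2 pB P (h i)) /\
    (forall j, j \in pV P -> #|` [fset i in pV P' | h i == j] | = 2).

Definition homogeneity (f : vccr_fun) : Prop :=
  forall P P', wf_profile P -> wf_profile P' -> doubled P P' -> same_rel (f P) (f P').

Definition downward_homogeneity (f : vccr_fun) : Prop :=
  forall P P', wf_profile P -> wf_profile P' -> doubled P P' ->
    forall x y, f P' x y -> f P x y.

Definition add_voter (P P' : profile) (i : Vt) : Prop :=
  [/\ i \notin pV P, pV P' = i |` pV P, pX P' = pX P &
      forall j, j \in pV P -> pB P' j =2 pB P j].

Definition neutral_indifference (f : vccr_fun) : Prop :=
  forall P P' i, wf_profile P -> wf_profile P' -> add_voter P P' i ->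
    pB P' i =2 (fun _ _ => false) -> same_rel (f P) (f P').

Definition neutral_reversal (f : vccr_fun) : Prop :=
  forall P P' i j, wf_profile P -> wf_profile P' ->
    i \notin pV P -> j \notin pV P -> i != j ->
    pV P' = i |` (j |` pV P) -> pX P' = pX P ->
    (forall k, k \in pV P -> pB P' k =2 pB P k) ->
    pB P' j =2 (fun a b => pB P' i b a) ->
    same_rel (f P) (f P').

(* R' results from R (a strict weak order on X) by moving x up one place *)
Definition move_up (X : {fset Xt}) (R R' : rel Xt) (x : Xt) : Prop :=
  x \in X /\
  exists x', x' \in X /\ x' != x /\ ~~ R x x' /\
    (forall z, z \in X -> z != x -> ~~ R x z -> ~~ R x' z) /\
    (forall a b, a \in X -> b \in X -> a != x -> b != x -> R' a b = R a b) /\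
    (tied R x x' ->
       [/\ forall z, z \in X -> z != x -> ~~ tied R' x z,
           R' x x' &
           forall y, y \in X -> R y x -> R' y x]) /\
    ((forall z, z \in X -> z != x -> ~~ tied R x z) -> tied R' x x').

Definition monotonicity_gen (two : bool) (f : vccr_fun) : Prop :=
  forall P P' i x, wf_profile P -> wf_profile P' ->
    (two ==> (#|` pX P| == 2)) ->
    pV P' = pV P -> pX P' = pX P -> i \in pV P ->
    (forall j, j \in pV P -> j != i -> pB P' j =2 pB P j) ->
    move_up (pX P) (pB P i) (pB P' i) x ->
    forall y, f P x y -> f P' x y.

Definition monotonicity := monotonicity_gen false.
Definition monotonicity_two := monotonicity_gen true.

Definition coherent_step (P P' : profile) (x y : Xt) : Prop :=
  [/\ pV P' = pV P, x \in pX P' & y \in pX P'] /\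
      (forall i, i \in pV P -> pB P' i x y = pB P i x y /\ pB P' i y x = pB P i y x) /\
      (* M(P') obtained from M(P) by deleting candidates other than x, y ... *)
      pX P' `<=` pX P /\
      (* ... and deleting / reducing weights of edges (every edge of M(P') is an
         edge of M(P) with at least the same weight; for the x-y edge equality
         already follows from the restriction condition) *)
      forall a b, a \in pX P' -> b \in pX P' -> ~~ ([fset a; b] == [fset x; y]) ->
        (0 < margin P' a b)%R -> (0 < margin P a b)%R /\ (margin P' a b <= margin P a b)%R.

Definition coherent_IIA (f : vccr_fun) : Prop :=
  forall P P' x y, wf_profile P -> wf_profile P' -> coherent_step P P' x y ->
    f P x y -> f P' x y.

Definition coherent_defeat (f : vccr_fun) : Prop :=
  forall P x y, wf_profile P -> (0 < margin P x y)%R ->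
    (forall s, maj_path P y s -> last y s != x) -> f P x y.

Definition positive_involvement_defeat (f : vccr_fun) : Prop :=
  forall P P' i x y, wf_profile P -> wf_profile P' -> add_voter P P' i ->
    pB P' i y x -> ~ f P x y -> ~ f P' x y.

End Voting.

(* Main.v *)
Require Import Defs.
From mathcomp Require Import all_boot all_order all_algebra.
From mathcomp Require Import finmap zify boolp.
Set Implicit Arguments. Unset Strict Implicit. Unset Printing Implicit Defensive.
Import Order.TTheory GRing.Theory Num.Theory.
Local Open Scope fset_scope.

(* Split Cycle says that x defeats y iff m = margin x y > 0 and no path from y to x
   uses only edges of weight at least m; part (i) follows from how each operation acts
   on margins.  For uniqueness, a defeat under Split Cycle is one under f because adding
   m - 1 voters with y above x can cut all majority paths from y to x while x keeps
   margin 1 over y: Coherent Defeat applies, and Positive Involvement takes the voters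
   away again.  Conversely, up to the parity of the number of voters, f depends only on
   the margin graph; were x to defeat y on a cycle through edges of weight at least m,
   Coherent IIA would reduce the cycle to a uniform one, where by symmetry everybody is
   defeated. *)

(** * Paths, cycles and permutations of finite sequences *)

Lemma path_avoid (T : eqType) (e e' : rel T) (x y : T) s :
  (forall u v, u != x -> e u v -> e' u v) -> path e y s -> x \notin belast y s ->
  path e' y s.
Proof.
move=> H; elim: s y => [//|z s IH] y /= /andP[yz zs].
by rewrite inE negb_or => /andP[xy xs]; rewrite IH // H // eq_sym.
Qed.

Lemma perm_eq_map_inj (T : choiceType) (A : {fset T}) (f : T -> T) :
  {in A, forall z, f z \in A} -> {in A &, injective f} ->
  perm_eq [seq f z | z <- A] A.
Proof.
move=> fA f_inj; have us : uniq [seq f z | z <- A] by rewrite map_inj_in_uniq.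
have ss : {subset [seq f z | z <- A] <= A} by move=> _ /mapP[z /fA ? ->].
have [_ e] := uniq_min_size us ss (eq_leq (esym (size_map _ _))).
exact: uniq_perm.
Qed.

Lemma next_neq (T : eqType) (c : seq T) u v w :
  uniq c -> u \in c -> v \in c -> w \in c -> v != w -> next c u != u.
Proof.
move=> uc uin vin win vw; have [i c' ec] := rot_to uin.
rewrite -(next_rot i uc) ec; move: (uc) vin win.
rewrite -(rot_uniq i) -!(mem_rot i c) ec.
case: c' {ec} => [|t c'] /=; first by rewrite !inE => _ /eqP ev /eqP ew; rewrite ev ew eqxx in vw.
by rewrite eqxx inE negb_or eq_sym => /andP[/andP[]].
Qed.

Lemma iter_next (T : eqType) (c : seq T) u w : uniq c -> u \in c -> w \in c ->
  exists j : nat, w = iter j (next c) u.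
Proof.
move=> uc uin win; have [i c' ec] := rot_to uin.
have: fcycle (next c) (rot i c).
  rewrite -(eq_cycle (e := frel (next (rot i c)))); first by apply: cycle_next; rewrite rot_uniq.
  by move=> a b /=; rewrite next_rot.
rewrite ec /= => /fpathP [n en].
have : w \in rcons c' u by rewrite mem_rcons -ec mem_rot.
by rewrite en => /trajectP [j _ ->]; exists j.+1; rewrite iterSr.
Qed.

(** Meant for labels recording who ranks x above y and who ranks y above x. Excluding [(true, true)]
    leaves three labels, and the size with the two counts fixes their multiplicities. *)
Lemma perm_eq_bool_pairs (s t : seq (bool * bool)) :
  (true, true) \notin s -> (true, true) \notin t -> size s = size t ->
  count (fun p => p.1) s = count (fun p => p.1) t ->
  count (fun p => p.2) s = count (fun p => p.2) t -> perm_eq s t.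
Proof.
have E r : (true, true) \notin r -> [/\ count_mem (true, true) r = 0%N,
    count_mem (true, false) r = count (fun p => p.1) r,
    count_mem (false, true) r = count (fun p => p.2) r &
    size r = (count_mem (false, false) r + count (fun p => p.1) r + count (fun p => p.2) r)%N].
  elim: r => [//|[c d] r IH]; rewrite inE negb_or => /andP[ncd /IH[]] /=.
  by case: c ncd; case: d => //= _ h1 h2 h3 h4; split; lia.
move=> /E [s1 s2 s3 s4] /E [t1 t2 t3 t4] es e1 e2.
apply/allP => p _; apply/eqP; case: p => -[] [];
  rewrite ?s1 ?t1 ?s2 ?t2 ?s3 ?t3 //.
by move: s4; rewrite es t4 e1 e2 => /addIn /addIn ->.
Qed.

(** Equal label multisets give a permutation of positions by [perm_iotaP]; carried over by [index],
    it permutes [A], as Anonymity requires. *)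
Lemma perm_eq_reindex (T : choiceType) (L : eqType) (A : {fset T}) (g h : T -> L) :
  perm_eq [seq h z | z <- A] [seq g z | z <- A] ->
  exists pi : T -> T, [/\ {in A, forall z, pi z \in A}, {in A &, injective pi} &
    {in A, forall z, h z = g (pi z)}].
Proof.
case: (fset_0Vmem A) => [-> _|[z0 z0A]]; first by exists id; split=> // z; rewrite inE.
case/(perm_iotaP (g z0)) => Is; rewrite size_map => pIs eh.
have sIs : size Is = size A by rewrite (perm_size pIs) size_iota.
have ltIs z : z \in A -> (nth 0%N Is (index z A) < size A)%N.
  move=> zA; have : nth 0%N Is (index z A) \in Is by rewrite mem_nth // sIs index_mem.
  by rewrite (perm_mem pIs) mem_iota.
exists (fun z => nth z0 A (nth 0%N Is (index z A))); split.
- by move=> z zA; apply: mem_nth; exact: ltIs.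
- move=> z w zA wA /eqP; rewrite nth_uniq ?ltIs // nth_uniq ?sIs ?index_mem //.
    by move/eqP/(congr1 (nth z0 A)); rewrite !nth_index.
  by rewrite (perm_uniq pIs) iota_uniq.
- move=> z zA; transitivity (nth (h z0) [seq h z | z <- A] (index z A)).
    by rewrite (nth_map z0) ?index_mem // nth_index.
  rewrite eh (nth_map 0%N) ?sIs ?index_mem // (nth_map z0) //; exact: ltIs.
Qed.

(** * Margins and Split Cycle *)

Section SplitCycle.
Variables (Vt Xt : choiceType).
Implicit Types (P Q : profile Vt Xt) (a b x y : Xt) (i j : Vt).

Lemma nvotersE P a b : nvoters P a b = (\sum_(i <- pV P) pB P i a b)%N.
Proof.
rewrite /nvoters card_fset_sum1 big_fset /= big_mkcond /=.
by apply: eq_bigr => i _; case: (pB P i a b).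
Qed.

Lemma eq_nvoters P Q a b : pV Q = pV P ->
  (forall i, i \in pV P -> pB Q i a b = pB P i a b) -> nvoters Q a b = nvoters P a b.
Proof.
by move=> eV eB; rewrite !nvotersE eV; apply: eq_big_seq => i /eB ->.
Qed.

Lemma marginC P a b : margin P a b = (- margin P b a)%R.
Proof. by rewrite /margin opprB. Qed.

Lemma margin_refl P a : margin P a a = 0%R.
Proof. by rewrite /margin subrr. Qed.

Lemma margin_mem P a b : wf_profile P -> (0 < margin P a b)%R ->
  a \in pX P /\ b \in pX P.
Proof.
case=> _ _ _ can; rewrite /margin => m_gt0.
have : nvoters P a b != 0%N by lia.
rewrite cardfs_eq0 => /fset0Pn [i].
by rewrite !inE /= => /andP[_ /can[]].
Qed.

Lemma ballot_asym P i a b : wf_profile P -> pB P i a b -> ~~ pB P i b a.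
Proof.
case=> _ _ wo can ab; have [iV aX bX] := can _ _ _ ab.
have [irr tr _] := wo _ iV; apply/negP => ba.
by have := irr _ aX; rewrite (tr _ _ _ aX bX aX ab ba).
Qed.

Definition heavy P (m : int) : rel Xt := fun u v => (m <= margin P u v)%R.

Lemma le_strength P (m : int) x s : s != [::] ->
  (m <= strength P x s)%R = path (heavy P m) x s.
Proof.
elim: s x => [//|y s IH] x _; case: s IH => [|z s] IH.
  by rewrite /= andbT.
have -> : strength P x [:: y, z & s] =
  Order.min (margin P x y) (strength P y (z :: s)) by [].
by rewrite le_min IH.
Qed.

(** Because the margin of x over y is positive, edges heavy at that threshold are majority edges;
    the empty path matters only for x = y, where the margin is 0. *)
Lemma scP P x y : sc P x y <->
  (0 < margin P x y)%R /\
  forall s, path (heavy P (margin P x y)) y s -> last y s <> x.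
Proof.
split=> -[m_gt0 H]; split=> // s.
  move=> hs ls; case: (eqVneq s [::]) => [s0|s0].
    by move: ls m_gt0; rewrite s0 /= => ->; rewrite margin_refl.
  suff ms : maj_path P y s.
    by have := H s ms ls; rewrite ltNge le_strength // hs.
  rewrite /maj_path s0; apply: sub_path hs => u v; rewrite /heavy; lia.
case/andP=> s0 _ ls; rewrite ltNge; apply/negP.
by rewrite le_strength // => /H; apply.
Qed.

Lemma sc_vccr : is_vccr (@sc Vt Xt).
Proof.
move=> P wfP; split=> x y [xy _]; first exact: margin_mem xy.
by case; rewrite marginC; lia.
Qed.

(** Split Cycle only compares margins with 0 and with each other, which scaling by k > 0 preserves;
    k = 1 and k = 2 are the cases used. *)
Lemma sc_scale P Q (k : int) : (0 < k)%R ->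
  (forall a b, margin Q a b = k * margin P a b)%R -> same_rel (sc P) (sc Q).
Proof.
move=> k0 e x y; rewrite !scP e pmulr_rgt0 //.
have E : heavy Q (k * margin P x y)%R =2 heavy P (margin P x y).
  by move=> u v; rewrite /heavy e ler_pM2l.
by split=> -[? H]; split=> // s; [rewrite (eq_path E)|rewrite -(eq_path E)]; exact: H.
Qed.

Lemma eq_margin_sc P Q : (forall a b, margin Q a b = margin P a b) ->
  same_rel (sc P) (sc Q).
Proof. by move=> e; apply: (@sc_scale _ _ 1%R) => // a b; rewrite mul1r. Qed.

Lemma nvoters_perm P Q (pi : Vt -> Vt) a b : pV Q = pV P ->
  {in pV P, forall i, pi i \in pV P} -> {in pV P &, injective pi} ->
  (forall i, i \in pV P -> pB Q i a b = pB P (pi i) a b) ->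
  nvoters Q a b = nvoters P a b.
Proof.
move=> eV piV pi_inj eB; rewrite !nvotersE eV.
rewrite -[RHS](perm_big _ (perm_eq_map_inj piV pi_inj)) big_map.
by apply: eq_big_seq => i /eB ->.
Qed.

(** * Axioms for Split Cycle: renaming, doubling and cancelling ballots *)

Lemma sc_anonymity : anonymity (@sc Vt Xt).
Proof.
move=> P Q pi _ _ eV _ piV pi_inj eB; apply: eq_margin_sc => a b.
by rewrite /margin !(nvoters_perm eV piV pi_inj) // => i /eB ->.
Qed.

Lemma sc_neutrality : neutrality (@sc Vt Xt).
Proof.
move=> P Q pi wfP wfQ eV eX piX pi_inj eB.
have eM a b : a \in pX P -> b \in pX P -> margin Q (pi a) (pi b) = margin P a b.
  move=> aX bX; rewrite /margin !nvotersE eV.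
  by congr (_%:Z - _%:Z)%R; apply: eq_big_seq => i iV; rewrite -eB.
have sur z : z \in pX P -> exists2 u, u \in pX P & z = pi u.
  by rewrite -[z \in _](perm_mem (perm_eq_map_inj piX pi_inj)) => /mapP.
move=> x y xX yX; rewrite !scP eM //; split=> -[m0 H]; split=> // s.
(* The map [pi] is onto only within the candidates. The path starts at a candidate and its edges
   have positive margin, so all its vertices are candidates and it lifts through [pi]. *)
- move=> hs ls; suff [t ht lt] : exists2 t, path (heavy P (margin P x y)) y t &
      last y t \in pX P /\ pi (last y t) = last (pi y) s.
    by apply: (H t ht); apply: pi_inj; [case: lt|done|rewrite -ls; case: lt].
  elim: s y yX {m0 H ls} (margin P x y) m0 hs => [|z s IH] y yX m m0 /=.
    by move=> _; exists [::].
  case/andP=> hz; have : (0 < margin Q (pi y) z)%R by rewrite /heavy in hz; lia.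
  case/(margin_mem wfQ) => _; rewrite eX => /sur [u uX ez]; subst z => /(IH _ uX _ m0).
  by case=> t ht lt; exists (u :: t) => //=; rewrite ht andbT /heavy -eM.
- move=> hs ls; apply: (H (map pi s)); last by rewrite last_map ls.
  elim: s y yX {H ls} (margin P x y) m0 hs => [|z s IH] y yX m m0 //=.
  case/andP=> hz hs; have : (0 < margin P y z)%R by rewrite /heavy in hz; lia.
  by case/(margin_mem wfP) => _ zX; rewrite /heavy eM //; apply/andP; split=> //; exact: IH.
Qed.

Lemma doubled_margin P Q a b : doubled P Q -> margin Q a b = (2 * margin P a b)%R.
Proof.
case=> _ [h [hV h2]].
suff E c d : nvoters Q c d = (2 * nvoters P c d)%N by rewrite /margin !E; lia.
rewrite !nvotersE big_distrr /=.
(* Double counting of pairs of a voter i of [Q] and its original j: each j has a fibre of size 2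
   under [h]. *)
transitivity (\sum_(i <- pV Q) \sum_(j <- pV P | j == h i) pB P j c d)%N.
  apply: eq_big_seq => i /hV [hi ->].
  by rewrite (@fbig_pred1_inj _ _ _ _ _ (fun j => (pB P j c d : nat)) id).
under eq_bigr do rewrite big_mkcond /=.
rewrite exchange_big /=; apply: eq_big_seq => j jV.
rewrite -(h2 _ jV) card_fset_sum1 big_fset /= -big_mkcond big_distrl /=.
by apply: eq_big => [i|i _]; rewrite 1?eq_sym ?mul1n.
Qed.

Lemma sc_homogeneity : homogeneity (@sc Vt Xt).
Proof.
move=> P Q _ _ d; apply: (@sc_scale _ _ 2%R) => // a b; exact: doubled_margin.
Qed.

Lemma sc_downward_homogeneity : downward_homogeneity (@sc Vt Xt).
Proof. by move=> P Q wfP wfQ d x y; case: (sc_homogeneity wfP wfQ d x y). Qed.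

Lemma nvoters_add P Q i a b : add_voter P Q i ->
  nvoters Q a b = (pB Q i a b + nvoters P a b)%N.
Proof.
case=> iV eV _ eB; rewrite !nvotersE eV big_fsetU1 //=.
by congr (_ + _)%N; apply: eq_big_seq => j /eB ->.
Qed.

Lemma sc_neutral_indifference : neutral_indifference (@sc Vt Xt).
Proof.
move=> P Q i _ _ add e; apply: eq_margin_sc => a b.
by rewrite /margin !(nvoters_add _ _ add) !e.
Qed.

Lemma sc_neutral_reversal : neutral_reversal (@sc Vt Xt).
Proof.
move=> P Q i j _ _ iV jV ij eV _ eB eR; apply: eq_margin_sc => a b.
have E c d : nvoters Q c d = (pB Q i c d + (pB Q i d c + nvoters P c d))%N.
  rewrite !nvotersE eV !big_fsetU1 ?inE ?negb_or ?ij //= eR.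
  by do 2!congr (_ + _)%N; apply: eq_big_seq => k /eB ->.
by rewrite /margin !E; lia.
Qed.

(** * Axioms for Split Cycle: Coherent Defeat, Positive Involvement, Coherent IIA *)

Lemma sc_coherent_defeat : coherent_defeat (@sc Vt Xt).
Proof.
move=> P x y _ m0 H; apply/scP; split=> // s hs ls.
case: (eqVneq s [::]) => [s0|s0].
  by move: ls m0; rewrite s0 /= => ->; rewrite margin_refl.
have : maj_path P y s; last by move/H; rewrite ls eqxx.
by rewrite /maj_path s0; apply: sub_path hs => u v; rewrite /heavy; lia.
Qed.

(** One ballot changes any margin by at most 1, and the new one lowers that of x over y by exactly
    1. So a path heavy at the higher threshold in [P] is heavy at the lower one in [Q]. *)
Lemma sc_positive_involvement : positive_involvement_defeat (@sc Vt Xt).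
Proof.
move=> P Q i x y _ wfQ add byx nsc /scP [m0 H]; apply: nsc.
have E a b : margin Q a b = (margin P a b + ((pB Q i a b)%:Z - (pB Q i b a)%:Z))%R.
  by rewrite /margin !(nvoters_add _ _ add); lia.
have Exy : margin P x y = (margin Q x y + 1)%R.
  by rewrite E byx (negPf (ballot_asym wfQ byx)); lia.
apply/scP; split; first by lia.
move=> s hs; apply: H; apply: sub_path hs => u v; rewrite /heavy Exy (E u v).
by case: (pB Q i u v); case: (pB Q i v u); lia.
Qed.

Lemma sc_coherent_IIA : coherent_IIA (@sc Vt Xt).
Proof.
move=> P Q x y wfP wfQ [[eV xX yX] [eB [sX wt]]] /scP [m0 H].
have exy : margin Q x y = margin P x y.
  by rewrite /margin !(eq_nvoters eV) // => i /eB [].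
apply/scP; rewrite exy; split=> // s hs; apply: H; apply: sub_path hs => u v.
rewrite /heavy => muv; have [uX vX] := @margin_mem Q u v wfQ ltac:(lia).
case: (boolP ([fset u; v] == [fset x; y])) => [/eqP e|ne].
  have := fset21 u v; have := fset22 u v; rewrite e !inE.
  have myx := marginC Q y x.
  by move=> /orP[]/eqP ev /orP[]/eqP eu; move: muv; rewrite eu ev ?margin_refl -?exy; lia.
by case: (wt _ _ uX vX ne); lia.
Qed.

(** * Axioms for Split Cycle: Monotonicity and Availability *)

Lemma move_up_ballot (X : {fset Xt}) (R R' : rel Xt) x :
  strict_weak_order X R -> strict_weak_order X R' -> move_up X R R' x ->
  forall z, z \in X -> z != x -> (R x z -> R' x z) /\ (R' z x -> R z x).
Proof.
move=> [irr tr nt] [irr' tr' nt'] [xX [x' [x'X [x'x [xx' [mn [ag [up1 up2]]]]]]]] z zX zx.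
have as' a b : a \in X -> b \in X -> R' a b -> ~~ R' b a.
  by move=> aX bX ab; apply/negP => ba; move: (irr' _ aX); rewrite (tr' _ _ _ aX bX aX ab ba).
have as_ a b : a \in X -> b \in X -> R a b -> ~~ R b a.
  by move=> aX bX ab; apply/negP => ba; move: (irr _ aX); rewrite (tr _ _ _ aX bX aX ab ba).
(* If x' is strictly above x, its minimality leaves x tied with nobody, and moving up ties x with
   x'. Otherwise the two are tied, and moving up puts x strictly above x'. *)
case: (boolP (R x' x)) => [x'Rx|ntie].
  have tie : tied R' x x'.
    apply: up2 => w wX wx; apply/negP => /andP[xw].
    by apply/negP; apply: contraTN x'Rx; apply: nt (mn _ wX wx xw).
  case/andP: tie => t1 t2.
  have below : R x z -> R' x z.
    move=> xz; apply/negPn/negP => nxz.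
    have : R' x' z by rewrite ag //; apply: tr xz.
    by apply/negP; apply: nt' nxz.
  split=> // z'x; apply/negPn/negP => nzx.
  have nxz : ~~ R x z by apply/negP => /below /as' -/(_ xX zX); rewrite z'x.
  have nx'z := mn _ zX zx nxz.
  have := nt _ _ _ x'X zX xX nx'z nzx; by rewrite x'Rx.
have [tie x'beat pres] := up1 ltac:(by rewrite /tied xx' ntie).
have below : ~~ R z x -> R' x z.
  move=> nzx; have := nt _ _ _ zX xX x'X nzx xx' => nzx'.
  have : ~~ R' z x' by rewrite ag.
  move=> n1; apply/negPn/negP => n2.
  by have := nt' _ _ _ xX zX x'X n2 n1; rewrite x'beat.
split; first by move/as_ => -/(_ xX zX) /below.
by move=> z'x; apply/negPn/negP => /below /as' -/(_ xX zX); rewrite z'x.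
Qed.

(** Edges out of x can only gain weight, edges into x only lose it, and the rest are fixed. A simple
    path from y to x uses no edge out of x, so none of its weights has grown, while the threshold
    has not dropped. *)
Lemma sc_monotonicity : monotonicity (@sc Vt Xt).
Proof.
move=> P Q i x wfP wfQ _ eV eX iV eB mu y sxy.
have [wo wo'] : strict_weak_order (pX P) (pB P i) /\ strict_weak_order (pX P) (pB Q i).
  by case: wfP wfQ => _ _ H _ [_ _ H' _]; rewrite -{2}eX; split; [apply: H|apply: H'; rewrite eV].
have up z : z != x -> (pB P i x z -> pB Q i x z) /\ (pB Q i z x -> pB P i z x).
  move=> zx; case: (boolP (z \in pX P)) => zX; first exact: move_up_ballot wo wo' mu _ zX zx.
  case: wfP wfQ => _ _ _ c [_ _ _ c'].
  by split; [case/c|case/c']; rewrite ?eX (negPf zX).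
have [_ [x' [_ [_ [_ [_ [ag _]]]]]]] := mu.
have mono z : z != x -> (margin P x z <= margin Q x z)%R.
  move=> zx; have le1 : (nvoters P x z <= nvoters Q x z)%N.
    rewrite !nvotersE eV; rewrite big_seq [X in (_ <= X)%N]big_seq; apply: leq_sum => j jV.
    case: (eqVneq j i) => [->|ji]; last by rewrite eB.
    by have [H _] := up z zx; case: (pB P i x z) H => // ->.
  suff le2 : (nvoters Q z x <= nvoters P z x)%N by rewrite /margin; lia.
  rewrite !nvotersE eV; rewrite big_seq [X in (_ <= X)%N]big_seq; apply: leq_sum => j jV.
  case: (eqVneq j i) => [->|ji]; last by rewrite eB.
  by have [_ H] := up z zx; case: (pB Q i z x) H => // ->.
have same a b : a != x -> b != x -> margin Q a b = margin P a b.
  suff N c d : c != x -> d != x -> nvoters Q c d = nvoters P c d.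
    by move=> ax bx; rewrite /margin !N.
  move=> cx dx; apply: eq_nvoters => // j jV.
  case: (eqVneq j i) => [->|ji]; last by rewrite eB.
  case: (boolP ((c \in pX P) && (d \in pX P))) => [/andP[cX dX]|cd]; first exact: ag.
  case: wfP wfQ => _ _ _ c1 [_ _ _ c2].
  by apply/idP/idP => [/c2|/c1] [_]; rewrite ?eX => cX dX; rewrite cX dX in cd.
have /scP [m0 H] := sxy.
have yx : y != x by apply: contraTneq m0 => ->; rewrite margin_refl.
apply/scP; split; first by have := mono y yx; lia.
move=> s hs; have := mono y yx.
case/shortenP: hs => s' hs' us' _ mle ls'.
apply: (H s') => //.
apply: (path_avoid (x := x) (e := heavy Q (margin Q x y))) => //; last first.
  by move: us'; rewrite lastI rcons_uniq -ls' => /andP[].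
move=> u v ux; rewrite /heavy; case: (eqVneq v x) => [->|vx].
  by rewrite [margin Q u x]marginC [margin P u x]marginC; have := mono u ux; lia.
by rewrite (same u v) //; lia.
Qed.

(** If everyone were defeated, iterating a choice [g] of defeaters would run into a cycle. The
    candidate v entered by a weakest edge is defeated by [g v], yet the rest of the cycle leads from
    v back to [g v] along edges at least as heavy. *)
Lemma sc_availability : availability (@sc Vt Xt).
Proof.
move=> P wfP; apply: contrapT => none.
have [x0 x0X] : exists x, x \in pX P by case: wfP => _ /fset0Pn.
have /choice [g gP] : forall x, exists y, x \in pX P -> sc P y x.
  move=> x; case: (boolP (x \in pX P)) => [xX|]; last by exists x.
  apply: contrapT => nd; apply: none; exists x; split=> // y yx.
  by apply: nd; exists y.
have gX x : x \in pX P -> g x \in pX P by move=> /gP [/(margin_mem wfP) []].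
have itX k x : x \in pX P -> iter k g x \in pX P.
  by move=> xX; elim: k => //= k; exact: gX.
have [u [n [uX n0 gu]]] : exists u n, [/\ u \in pX P, (0 < n)%N & iter n g u = u].
  have : looping g x0 #|` pX P|.
    apply/negPn; rewrite -looping_uniq; apply/negP => /uniq_leq_size H.
    have := H (enum_fset (pX P)); rewrite size_traject ltnn => /(_ _)/negP; apply=> //.
    by move=> _ /trajectP [k _ ->]; exact: itX.
  move/loopingP => /(_ #|` pX P|) /trajectP [k kn e].
  exists (iter k g x0), (#|` pX P| - k)%N; split; [exact: itX|lia|].
  by rewrite -iterD subnK // ltnW.
pose c z := margin P (g z) z.
have [k _ kmin] := @arg_minP _ _ _ (Ordinal n0) xpredT (fun k : 'I_n => c (iter k g u)) isT.
pose v := iter k g u; have vX : v \in pX P by exact: itX.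
have gv : iter n g v = v by rewrite /v -iterD addnC iterD gu.
(* Reducing exponents modulo the period n extends the minimum over n iterates to the whole orbit. *)
have cmin l : (c v <= c (iter l g v))%R.
  rewrite /v -iterD.
  have -> : iter (l + k) g u = iter ((l + k) %% n) g u.
    by rewrite {1}(divn_eq (l + k) n) addnC iterD iterM [iter (_ %/ _) _ _]iter_fix.
  exact: (kmin (Ordinal (ltn_pmod (l + k) n0)) isT).
have /scP [_ noback] := gP v vX.
suff [s hs ls] : exists2 s, path (heavy P (c v)) (iter n.-1.+1 g v) s &
    last (iter n.-1.+1 g v) s = g v.
  by apply: (noback s); move: hs ls; rewrite prednK // gv.
elim: n.-1 => [|l [s hs ls]]; first by exists [::].
exists (iter l.+1 g v :: s) => //=; rewrite hs andbT; exact: (cmin l.+1).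
Qed.

End SplitCycle.

(** * Adding voters; Split Cycle defeats are defeats under [f] *)

Section Uniqueness.
Variables (Vt Xt : choiceType).
Hypothesis Vinf : forall s : {fset Vt}, exists i, i \notin s.
Implicit Types (P Q : profile Vt Xt) (X : {fset Xt}) (R : rel Xt) (a b x y : Xt) (i j : Vt).

Definition ballot X R : Prop :=
  strict_weak_order X R /\ forall a b, R a b -> a \in X /\ b \in X.

Definition ranking X (score : Xt -> nat) : rel Xt :=
  fun a b => [&& a \in X, b \in X & (score b < score a)%N].

Lemma ranking_ballot X score : ballot X (ranking X score).
Proof.
split; last by move=> a b /and3P[].
split=> [a aX|a b c aX bX cX|a b c aX bX cX]; rewrite /ranking ?aX ?bX ?cX /=; lia.
Qed.

Lemma converse_ballot X R : ballot X R -> ballot X (fun a b => R b a).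
Proof.
case=> [[irr tr nt] can]; split; last by move=> a b /can [].
split=> // a b c aX bX cX H1 H2; [exact: tr cX bX aX H2 H1|exact: nt cX bX aX H2 H1].
Qed.

Definition adjoin P i R : profile Vt Xt :=
  Profile (i |` pV P) (pX P) (fun j => if j == i then R else pB P j).

Lemma adjoin_wf P i R : wf_profile P -> ballot (pX P) R -> wf_profile (adjoin P i R).
Proof.
case=> V0 X0 wo can [swoR canR]; split=> //=.
- by apply/fset0Pn; exists i; rewrite !inE eqxx.
- by move=> j; rewrite !inE; case: eqP => //= _; exact: wo.
- by move=> j a b; rewrite !inE; case: eqP => /= _; [case/canR|case/can].
Qed.

Lemma adjoin_add P i R : i \notin pV P -> add_voter P (adjoin P i R) i.
Proof.
by move=> iV; split=> //= j jV; case: eqP => // ji; rewrite -ji jV in iV.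
Qed.

Lemma nvoters_adjoin P i R a b : i \notin pV P ->
  nvoters (adjoin P i R) a b = (R a b + nvoters P a b)%N.
Proof. by move=> /(adjoin_add R)/nvoters_add ->; rewrite /= eqxx. Qed.

Lemma margin_adjoin P i R a b : i \notin pV P ->
  margin (adjoin P i R) a b = (margin P a b + ((R a b)%:Z - (R b a)%:Z))%R.
Proof. by move=> iV; rewrite /margin !nvoters_adjoin //; lia. Qed.

(** The last clause is the contrapositive of Positive Involvement, iterated: removing a voter who
    ranks y above x preserves a defeat of y by x. *)
Lemma adjoin_copies P R (k : nat) : wf_profile P -> ballot (pX P) R ->
  exists Q, [/\ wf_profile Q, pX Q = pX P,
    forall a b, margin Q a b = (margin P a b + k%:Z * ((R a b)%:Z - (R b a)%:Z))%R &
    forall (f : vccr_fun Vt Xt) x y, positive_involvement_defeat f ->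
      R y x -> f Q x y -> f P x y].
Proof.
move=> wfP bR; elim: k => [|k [Q [wfQ eX eM inv]]].
  by exists P; split=> // a b; rewrite mul0r addr0.
have [i iV] := Vinf (pV Q); have bR' : ballot (pX Q) R by rewrite eX.
exists (adjoin Q i R); split=> //; first exact: adjoin_wf.
  by move=> a b; rewrite margin_adjoin // eM; lia.
move=> f x y pid yx fxy; apply: (inv f x y pid yx); apply: contrapT => nf.
apply: (pid _ _ _ _ _ wfQ (adjoin_wf i wfQ bR') (adjoin_add R iV) _ nf fxy).
by rewrite /= eqxx.
Qed.

(* With m = margin x y and S the set reached from y along edges of weight at
   least m, every edge leaving S weighs less than m, so m - 1 further voters
   against those edges cut all majority paths from y to x; ranking y just above x
   leaves x one vote ahead of y. *)
Lemma sc_sub (f : vccr_fun Vt Xt) P x y :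
  coherent_defeat f -> positive_involvement_defeat f -> wf_profile P ->
  sc P x y -> f P x y.
Proof.
move=> cd pid wfP /scP [m0 H]; set m := margin P x y in m0 H.
pose S u := `[< exists2 s, path (heavy P m) y s & last y s = u >].
have Sx : ~~ S x by apply/asboolP => -[s /H].
have Sy : S y by apply/asboolP; exists [::].
have Sstep u v : S u -> (m <= margin P u v)%R -> S v.
  move=> /asboolP [s hs ls] uv; apply/asboolP; exists (rcons s v); last by rewrite last_rcons.
  by rewrite rcons_path hs ls.
have [xX yX] := margin_mem wfP m0.
have yx : y != x by apply: contraNneq Sx => <-.
(* From the top: candidates outside S other than x, then y, then x, then the rest of S. These
   ballots oppose every edge leaving S except that from y to x. *)
pose score u := (if u == y then 2 else if u == x then 1 else if S u then 0 else 3)%N.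
have [Q [wfQ eX eM inv]] := adjoin_copies (`|m|%N).-1 wfP (ranking_ballot (pX P) score).
have Rxy : ranking (pX P) score y x = true.
  by rewrite /ranking xX yX /score eqxx eq_sym (negPf yx) eqxx.
have Rxy' : ranking (pX P) score x y = false.
  by rewrite /ranking xX yX /score eqxx eq_sym (negPf yx) eqxx.
have mQ : margin Q x y = 1%R by rewrite eM Rxy Rxy' -/m; lia.
apply: (inv f) => //; apply: cd; rewrite ?mQ // => s /andP[_ hs].
have Qstep u v : S u -> (0 < margin Q u v)%R -> S v.
  move=> Su uv; apply: contraTT (uv) => Sv; rewrite -leNgt.
  have [uX vX] := margin_mem wfQ uv; rewrite !eX in uX vX.
  case: (boolP ((u == y) && (v == x))) => [/andP[/eqP-> /eqP->]|ne].
    by rewrite marginC mQ.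
  have vy : v != y by apply: contraNneq Sv => ->.
  have ux : u != x by apply: contraNneq Sx => <-.
  have Rvu : ranking (pX P) score v u = true.
    rewrite /ranking uX vX /score (negPf vy) (negPf ux) Su (negPf Sv) /=.
    by move: ne; case: (u == y); case: (v == x).
  have Ruv : ranking (pX P) score u v = false.
    by apply: contraTF Rvu => /and3P[_ _]; rewrite /ranking uX vX /= -leqNgt => /ltnW.
  have : (margin P u v < m)%R by rewrite ltNge; apply: contraNN Sv; exact: Sstep.
  by move: m0; rewrite eM Rvu Ruv; clear; lia.
suff Sl : S (last y s) by apply: contraNneq Sx => <-.
elim: s (y) Sy hs => [//|v s IH] u Su /= /andP[uv]; exact/IH/(Qstep u).
Qed.

(** * Realizing margin graphs and reducing [f] to them *)

Lemma fresh_superset (A : {fset Vt}) (n : nat) :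
  exists2 W : {fset Vt}, A `<=` W & #|` W| = (#|` A| + n)%N.
Proof.
elim: n => [|n [W AW cW]]; first by exists A; rewrite ?addn0.
have [i iW] := Vinf W; exists (i |` W); first exact: fsubset_trans AW (fsubsetU1 _ _).
by rewrite cardfsU1 iW cW addnCA add1n addnS.
Qed.

(* An edge from u to v of weight 1 is realized by the two ballots
   u > v > others and others > u ~ v, whose other margins cancel. *)
Lemma margin_graph_exists X (L : seq (Xt * Xt)) (b : bool) : X != fset0 ->
  all (fun e => [&& e.1 != e.2, e.1 \in X & e.2 \in X]) L ->
  exists Q, [/\ wf_profile Q, pX Q = X, odd #|` pV Q| = b &
    forall u v, margin Q u v = ((count_mem (u, v) L)%:Z - (count_mem (v, u) L)%:Z)%R].
Proof.
move=> X0; elim: L => [_|[u v] L IH /= /andP[/and3P[uv uX vX] /IH]].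
  (* One or two indifferent voters set the parity with a nonempty electorate; each edge then adds
     two voters and keeps it. *)
  have [W _ cW] := fresh_superset fset0 (if b then 1 else 2).
  exists (Profile W X (fun _ _ _ => false)); split=> //.
  - by split=> //=; rewrite -cardfs_gt0 cW cardfs0; case: (b).
  - by rewrite /= cW cardfs0; case: (b).
  - by move=> u v; rewrite /margin !nvotersE !big1.
case=> Q [wfQ eX eV eM].
pose sA w := (if w == u then 2 else if w == v then 1 else 0)%N.
pose sB w := (if w == u then 0 else if w == v then 0 else 1)%N.
have [i iV] := Vinf (pV Q); pose Q1 := adjoin Q i (ranking X sA).
have [j jV] := Vinf (pV Q1).
have wf1 : wf_profile Q1 by apply: adjoin_wf => //; rewrite eX; exact: ranking_ballot.
exists (adjoin Q1 j (ranking X sB)); split=> //.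
- by apply: adjoin_wf => //; rewrite /= eX; exact: ranking_ballot.
- rewrite /= cardfsU1 jV cardfsU1 iV -eV; lia.
have key a c : ((ranking X sA a c)%:Z - (ranking X sA c a)%:Z +
    ((ranking X sB a c)%:Z - (ranking X sB c a)%:Z) =
    ((u == a) && (v == c))%:Z - ((u == c) && (v == a))%:Z)%R.
  have notin w z : w \in X -> z \notin X -> (w == z) = false.
    by move=> wX; apply: contraNF => /eqP <-.
  rewrite /ranking; case: (boolP (a \in X)) => aX; last first.
    by rewrite !(notin _ a) ?andbF.
  case: (boolP (c \in X)) => cX; last by rewrite !(notin _ c) ?andbF.
  have one w : ~~ ((u == w) && (v == w)).
    by apply: contraNN uv => /andP[/eqP-> /eqP->].
  move: (one a) (one c); rewrite /= /sA /sB ![_ == u]eq_sym ![_ == v]eq_sym.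
  by case: (u == a); case: (u == c); case: (v == a); case: (v == c).
move=> a c; rewrite margin_adjoin // margin_adjoin // eM -[LHS]addrA key.
by rewrite /= !xpair_eqE !PoszD; clear; lia.
Qed.

(** Pairs of converse ballots fill the electorate up to [W] without altering [f] or any margin. Each
    of the first n pairs ranks x alone at the top and at the bottom, adding one vote for x over y;
    the other pairs are indifferent. *)
Lemma pad_reversals (f : vccr_fun Vt Xt) P (W : {fset Vt}) (k n : nat) x y :
  neutral_reversal f -> wf_profile P -> x \in pX P -> y \in pX P -> x != y ->
  pV P `<=` W -> #|` W| = (#|` pV P| + k.*2)%N -> (n <= k)%N ->
  exists Q, [/\ wf_profile Q, pV Q = W, pX Q = pX P, same_rel (f P) (f Q) &
    (forall a b, margin Q a b = margin P a b) /\ nvoters Q x y = (nvoters P x y + n)%N].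
Proof.
move=> nr; elim: k n P => [|k IH] n P wfP xX yX xy VW cW nk.
  exists P; split=> //; last by move: nk; rewrite leqn0 => /eqP ->; rewrite addn0.
  by apply/eqP; rewrite eqEfcard VW cW double0 addn0 leqnn.
have fresh (A : {fset Vt}) : A `<=` W -> (#|` A| < #|` W|)%N ->
    exists2 i, i \in W & i \notin A.
  move=> AW lt; have : #|` W `\` A| != 0%N.
    by have := cardfsD W A; move/fsetIidPr: AW => ->; lia.
  by rewrite cardfs_eq0 => /fset0Pn[i]; rewrite inE => /andP[]; exists i.
have [j jW jV] := fresh _ VW ltac:(rewrite cW; lia).
have VW1 : j |` pV P `<=` W by rewrite fsubUset fsub1set jW.
have [i iW iV] := fresh _ VW1 ltac:(rewrite cardfsU1 jV cW; lia).
pose R := ranking (pX P) (fun z => (0 < n) && (z == x))%N.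
pose P1 := adjoin P j (fun a b => R b a); pose P2 := adjoin P1 i R.
have bR : ballot (pX P) R := ranking_ballot _ _.
have wf1 : wf_profile P1 by apply: adjoin_wf => //; exact: converse_ballot.
have wf2 : wf_profile P2 by apply: adjoin_wf.
have ij : i != j by apply: contraNneq iV => ->; rewrite !inE eqxx.
have eM a b : margin P2 a b = margin P a b.
  by rewrite !margin_adjoin // -addrA -[X in (_ + (X + _))%R]opprB addNr addr0.
have Rxy : R x y = (0 < n)%N.
  by rewrite /R /ranking xX yX eqxx [y == x]eq_sym (negPf xy) andbF andbT; case: (0 < n)%N.
have Ryx : R y x = false.
  by rewrite /R /ranking xX yX [y == x]eq_sym (negPf xy) andbF /= ltn0.
have [|||||||Q [wfQ eV eX eF [eM' eN]]] := IH n.-1 P2 => //.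
- by rewrite /= fsubUset fsub1set iW.
- by rewrite /= cardfsU1 iV cardfsU1 jV cW; lia.
- by lia.
exists Q; split=> //; last split.
- move=> a b; rewrite -eF; apply: (nr P P2 i j wfP wf2 _ jV ij) => //=.
  + by move: iV; rewrite !inE negb_or => /andP[].
  + move=> l lV; case: eqP => [li|_]; first by move: iV; rewrite -li !inE lV orbT.
    by case: eqP => // lj; rewrite -lj lV in jV.
  + by rewrite !eqxx [j == i]eq_sym (negPf ij).
- by move=> a b; rewrite eM'.
- by rewrite eN !nvoters_adjoin // Rxy Ryx; lia.
Qed.

(* A version of Coherent IIA on margin graphs alone: it does not compare ballots or
   voter sets, except for the parity of the number of voters. *)
Lemma margin_coherence (f : vccr_fun Vt Xt) P Q x y :
  anonymity f -> neutral_reversal f -> coherent_IIA f ->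
  wf_profile P -> wf_profile Q -> odd #|` pV P| = odd #|` pV Q| ->
  x != y -> x \in pX Q -> y \in pX Q -> pX Q `<=` pX P ->
  margin Q x y = margin P x y ->
  (forall a b, a \in pX Q -> b \in pX Q -> [fset a; b] != [fset x; y] ->
     (0 < margin Q a b)%R -> (margin Q a b <= margin P a b)%R) ->
  f P x y -> f Q x y.
Proof.
move=> an nr ciia wfP wfQ par xy xQ yQ sX exy wt fxy.
have leN P' : (nvoters P' x y <= #|` pV P'|)%N.
  by apply: fsubset_leq_card; apply/fsubsetP => i; rewrite !inE => /andP[].
pose U := pV P `|` pV Q; pose N := (#|` pV P| + #|` pV Q|)%N.
have UP : (#|` pV P| <= #|` U|)%N by rewrite fsubset_leq_card // fsubsetUl.
have UQ : (#|` pV Q| <= #|` U|)%N by rewrite fsubset_leq_card // fsubsetUr.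
(* The parity term makes [W] exceed either electorate by an even number, and [N.*2] leaves room for
   N pairs. *)
have [W UW cW] := fresh_superset U (odd (#|` U| + #|` pV P|) + N.*2)%N.
have ev (A : profile Vt Xt) : odd #|` pV A| = odd #|` pV P| -> (#|` pV A| <= #|` U|)%N ->
    exists2 k, #|` W| = (#|` pV A| + k.*2)%N & (N <= k)%N.
  move=> pA UA; exists ((#|` W| - #|` pV A|)./2); last by rewrite cW; lia.
  by rewrite cW; lia.
have [k cP Nk] := ev P erefl UP; have [l cQ Nl] := ev Q (esym par) UQ.
have NP := leN P; have NQ := leN Q.
(* Each profile is given as many new votes for x over y as the other already has, so the totals
   agree; equal margins then equate the votes for y over x. *)
have [||||P' [wfP' VP' XP' fP' [MP' nP']]] :=
  @pad_reversals f P W k (nvoters Q x y) x y nr wfP _ _ xy _ cP.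
- exact: (fsubsetP sX).
- exact: (fsubsetP sX).
- exact: fsubset_trans (fsubsetUl _ _) UW.
- by lia.
have [||Q' [wfQ' VQ' XQ' fQ' [MQ' nQ']]] :=
  @pad_reversals f Q W l (nvoters P x y) x y nr wfQ xQ yQ xy _ cQ.
- exact: fsubset_trans (fsubsetUr _ _) UW.
- by lia.
pose lab A i := (pB A i x y, pB A i y x) : bool * bool.
have nlab A : wf_profile A -> (true, true) \notin [seq lab A i | i <- W].
  move=> wfA; apply/mapP => -[i _ [ixy iyx]].
  by have := ballot_asym wfA (esym ixy); rewrite -iyx.
have cnt A a b : pV A = W -> nvoters A a b = count (fun i => pB A i a b) W.
  by move=> <-; rewrite nvotersE -sumn_count sumnE big_map.
have nxy' : nvoters P' x y = nvoters Q' x y by rewrite nP' nQ' addnC.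
have nyx' : nvoters P' y x = nvoters Q' y x.
  have : margin Q' x y = margin P' x y by rewrite MQ' MP'.
  by rewrite /margin; lia.
have : perm_eq [seq lab Q' i | i <- W] [seq lab P' i | i <- W].
  apply: perm_eq_bool_pairs; rewrite ?nlab ?size_map // !count_map /preim /=.
    by rewrite -!cnt.
  by rewrite -!cnt.
case/perm_eq_reindex => pi [piW pi_inj lpi].
(* The padded [P] with voters renamed so that each ranks x and y as in [Q']; its margins are still
   those of [P]. *)
pose P2 := Profile W (pX P) (fun i => if i \in W then pB P' (pi i) else fun _ _ => false).
have wf2 : wf_profile P2.
  case: (wfP') => V0 X0 wo can; rewrite XP' in X0 wo can; split=> //=.
    by rewrite -VP'.
    by move=> i iW; rewrite iW; apply: wo; rewrite VP' piW.
  by move=> i a b; case: ifP => // iW /can [].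
have f2 : f P2 x y.
  have [|||H _] := an P' P2 pi wfP' wf2 (esym VP') (esym XP') _ _ _ x y.
  - by rewrite VP'.
  - by rewrite VP'.
  - by rewrite VP' => i iW a b; rewrite /= iW.
  - exact/H/fP'.
have M2 a b : margin P2 a b = margin P a b.
  rewrite -MP' /margin; congr (_%:Z - _%:Z)%R;
  by apply: (@nvoters_perm _ _ P' P2 pi); rewrite ?VP' // => i iW; rewrite /= iW.
apply/fQ'; apply: ciia wf2 wfQ' _ f2; split; [|split; [|split]].
- by split; rewrite ?XQ'.
- by move=> i iW; have := lpi i iW; rewrite /lab /= iW => -[-> ->].
- by rewrite XQ'.
- move=> a b; rewrite XQ' MQ' M2 => aX bX ne m0; have := wt a b aX bX ne m0.
  by split=> //; apply: lt_le_trans m0 _.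
Qed.

(* Keep only the cycle, with all its weights lowered to the margin of x over y.
   Rotation then preserves the margin graph, so every candidate on it is defeated by
   its predecessor, against availability. *)
Lemma no_defeat_on_cycle (f : vccr_fun Vt Xt) P x y s :
  anonymity f -> neutrality f -> availability f -> neutral_reversal f ->
  coherent_IIA f -> wf_profile P -> x != y -> (0 <= margin P x y)%R ->
  {subset y :: s <= pX P} -> path (heavy P (margin P x y)) y s -> last y s = x ->
  ~ f P x y.
Proof.
move=> an ne av nr ciia wfP xy; set m := margin P x y => m0 sub hs ls fxy.
(* Without repetitions [next] and [prev] are mutually inverse; the edge from x to y closes the
   cycle. *)
case/shortenP: hs (ls) => s' hs' us' ss' ls'; pose c := y :: s'; rewrite -/c in us'.
have cX : {subset c <= pX P}.
  by move=> z; rewrite inE => /predU1P[->|/ss' zs]; apply: sub; rewrite inE ?eqxx ?zs ?orbT.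
have yc : y \in c by rewrite inE eqxx.
have xc : x \in c by rewrite -ls' mem_last.
pose nx := next c; pose pv := prev c.
have pvK : cancel pv nx := next_prev us'; have nxK : cancel nx pv := prev_next us'.
have hc : cycle (heavy P m) c by rewrite /= rcons_path hs' ls' /heavy lexx.
have nxh u : u \in c -> (m <= margin P u (nx u))%R by move=> uc; exact: next_cycle hc uc.
have nxc u : (nx u \in c) = (u \in c) by exact: mem_next.
have pvc u : (pv u \in c) = (u \in c) by exact: mem_prev.
have nxx : nx x = y.
  by rewrite -ls'; have := next_nth c (last y s'); rewrite mem_last index_last //= nth_default.
have nxn u : u \in c -> nx u != u by move=> uc; exact: next_neq us' uc xc yc xy.
pose X := [fset z in c]; have XE z : (z \in X) = (z \in c) by rewrite in_fset.
pose L := flatten (nseq `|m|%N [seq (u, nx u) | u <- c]).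
have LE a b : a \in c -> count_mem (a, b) L = (`|m| * (nx a == b))%N.
  move=> ac; rewrite count_flatten map_nseq sumn_nseq mulnC count_map; congr (_ * _)%N.
  rewrite (@eq_count _ _ (fun u => (u == a) && (nx a == b))); last first.
    by move=> u; rewrite /= xpair_eqE; case: eqP => // ->.
  case: eqP => _; last by rewrite (eq_count (a2 := pred0)) ?count_pred0 // => u; rewrite andbF.
  rewrite (eq_count (a2 := pred1 a)) ?count_uniq_mem ?ac // => u; exact: andbT.
have [||Q [wfQ eX eV eM]] := @margin_graph_exists X L (odd #|` pV P|).
- by apply/fset0Pn; exists x; rewrite XE.
- apply/allP => e /flattenP [t /nseqP [-> _] /mapP [u uc ->]] /=.
  by rewrite !XE nxc uc eq_sym nxn.
have MQ a b : a \in c -> b \in c ->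
    margin Q a b = (m * ((nx a == b)%:Z - (nx b == a)%:Z))%R.
  by move=> ac bc; rewrite eM !LE //; case: (nx a == b); case: (nx b == a); lia.
(* On a cycle of length two the opposite edges cancel, but then m is at most -m, hence 0. *)
have mxy : margin Q x y = m.
  rewrite MQ // nxx eqxx; case: eqP => [e|_]; last by rewrite subr0 mulr1.
  by have := nxh y yc; rewrite e marginC -/m; lia.
have fQ : f Q x y.
  apply: margin_coherence an nr ciia wfP wfQ _ xy _ _ _ mxy _ fxy; rewrite ?eX ?XE //.
    by apply/fsubsetP => z; rewrite XE => /cX.
  move=> a b; rewrite !XE => ac bc _; rewrite MQ // => pos.
  case: eqP pos => [<- _|_]; last by case: (nx b == a); lia.
  by apply: le_trans (nxh a ac); case: (nx _ == a); lia.
(* The profile [Q] rotated one step: Neutrality carries the defeat of [nx u] by u one place further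
   into [Q'], and equal margins bring it back to [Q]. *)
pose Q' := Profile (pV Q) X (fun i a b => [&& a \in X, b \in X & pB Q i (pv a) (pv b)]).
have wfQ' : wf_profile Q'.
  case: (wfQ) => V0 X0 wo can; split=> //=; first by rewrite -eX.
    move=> i iV; have [irr tr nt] := wo i iV; rewrite eX in irr tr nt.
    split=> [a aX|a b d aX bX dX|a b d aX bX dX]; rewrite ?aX ?bX ?dX /=.
    - by apply: irr; rewrite XE pvc -XE.
    - by apply: tr; rewrite XE pvc -XE.
    - by apply: nt; rewrite XE pvc -XE.
  by move=> i a b /and3P[aX bX /can[]].
have MQ' a b : a \in c -> b \in c -> margin Q' a b = margin Q a b.
  move=> ac bc; have -> : margin Q' a b = margin Q (pv a) (pv b).
    by rewrite /margin !nvotersE; congr (_%:Z - _%:Z)%R; apply: eq_bigr => i _ /=;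
       rewrite !XE ac bc.
  by rewrite !MQ ?pvc // !pvK -!(can2_eq nxK pvK).
have step u : u \in c -> f Q u (nx u) -> f Q (nx u) (nx (nx u)).
  move=> uc fu.
  have [|||||H _] := ne Q Q' nx wfQ wfQ' erefl (esym eX) _ _ _ u (nx u).
  - by move=> z; rewrite eX !XE nxc.
  - by move=> z w _ _; exact: can_inj nxK _ _.
  - by move=> i a b _; rewrite eX !XE /= !XE !nxc => -> ->; rewrite !nxK.
  - by rewrite eX XE.
  - by rewrite eX XE nxc.
  apply: margin_coherence an nr ciia wfQ' wfQ _ _ _ _ _ _ _ (H fu); rewrite ?eX ?XE ?nxc //.
  - by rewrite eq_sym nxn ?nxc.
  - by rewrite MQ' ?nxc.
  - by move=> a b; rewrite !XE => ac bc _ _; rewrite MQ'.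
(* The predecessor of the undefeated z is an iterate of x under [nx], so the defeat carried along
   the cycle reaches z. *)
have [z [zX nz]] := av Q wfQ; rewrite eX XE in zX.
have [j ej] : exists j : nat, pv z = iter j nx x by apply: iter_next; rewrite ?pvc.
suff [jc fj] : iter j nx x \in c /\ f Q (iter j nx x) (nx (iter j nx x)).
  by apply: (nz (pv z)); rewrite -{2}(pvK z) ej.
by elim: (j) => [|l [lc fl]] /=; [rewrite nxx|rewrite nxc; split=> //; exact: step].
Qed.

(** The sign of the margin of x over y decides. Negative: Coherent Defeat on a two-candidate
    reduction yields the reverse defeat, against asymmetry. Zero: x and y form a cycle at threshold
    0. Positive: a heavy path from y to x closes a cycle. *)
Lemma sub_sc (f : vccr_fun Vt Xt) P x y :
  is_vccr f -> anonymity f -> neutrality f -> availability f -> neutral_reversal f ->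
  coherent_IIA f -> coherent_defeat f -> wf_profile P ->
  f P x y -> sc P x y.
Proof.
move=> vf an ne av nr ciia cd wfP fxy.
have [mem asym] := vf P wfP; have [xX yX] := mem _ _ fxy.
have xy : x != y by apply: contra_not_neq (asym _ _ fxy) => exy; rewrite exy in fxy *.
have noc := no_defeat_on_cycle an ne av nr ciia wfP xy.
have m_ge0 : (0 <= margin P x y)%R.
  rewrite leNgt; apply/negP => m0.
  have [||Q [wfQ eX eV eM]] := @margin_graph_exists [fset x; y]
    (nseq `|margin P x y|%N (y, x)) (odd #|` pV P|).
  - by apply/fset0Pn; exists x; rewrite !inE eqxx.
  - by apply/allP => e /nseqP [-> _] /=; rewrite eq_sym xy !inE !eqxx orbT.
  have MQ a b : margin Q a b =
      (`|margin P x y|%N%:Z * (((a, b) == (y, x))%:Z - ((b, a) == (y, x))%:Z))%R.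
    rewrite eM !count_nseq /= ![(y, x) == _]eq_sym.
    by case: ((a, b) == _); case: ((b, a) == _); lia.
  have mxy : margin Q x y = margin P x y.
    by rewrite MQ eqxx xpair_eqE (negPf xy) /=; lia.
  have fQ : f Q x y.
    apply: margin_coherence an nr ciia wfP wfQ _ xy _ _ _ mxy _ fxy; rewrite ?eX //.
    - by rewrite !inE eqxx.
    - by rewrite !inE eqxx orbT.
    - by rewrite fsubUset !fsub1set xX yX.
    move=> a b _ _ nab; rewrite MQ => pos; case/eqP: nab.
    case: eqP pos => [[-> ->] _|_]; first by rewrite fsetUC.
    by case: eqP => [[-> ->]|_]; lia.
  have [_ asymQ] := vf Q wfQ; apply: (asymQ _ _ fQ); apply: cd => //.
    by rewrite marginC mxy; lia.
  case=> [//|z t] /andP[_ /= /andP[xz _]].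
  by exfalso; move: xz; rewrite MQ !xpair_eqE (negPf xy) /=; case: (z == y); lia.
have m_gt0 : (0 < margin P x y)%R.
  rewrite lt_neqAle m_ge0 andbT; apply/eqP => m0.
  apply: (noc [:: x] m_ge0 _ _ erefl fxy) => [z|].
    by rewrite !inE => /orP[]/eqP->.
  by rewrite /= /heavy [margin P y x]marginC -m0 oppr0 lexx.
apply/scP; split=> // s hs ls; apply: (noc s m_ge0 _ hs ls fxy).
move=> z; rewrite inE => /predU1P[-> //|].
move: {noc ls} (margin P x y) m_gt0 hs => m m_gt0.
elim: s (y) => [//|w s IH] u /= /andP[uw ws].
have [_ wX] := margin_mem wfP (lt_le_trans m_gt0 uw).
by rewrite inE => /predU1P[->|]; last exact: IH ws.
Qed.
End Uniqueness.

Theorem theorem7p10 (Vt Xt : choiceType)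
  (Vinf : forall s : {fset Vt}, exists i, i \notin s)
  (Xinf : forall s : {fset Xt}, exists x, x \notin s) :
  (* (i) *)
  (is_vccr (@sc Vt Xt) /\ anonymity (@sc Vt Xt) /\ neutrality (@sc Vt Xt) /\
   availability (@sc Vt Xt) /\ homogeneity (@sc Vt Xt) /\
   downward_homogeneity (@sc Vt Xt) /\ neutral_indifference (@sc Vt Xt) /\
   neutral_reversal (@sc Vt Xt) /\ monotonicity (@sc Vt Xt) /\
   coherent_IIA (@sc Vt Xt) /\ coherent_defeat (@sc Vt Xt) /\
   positive_involvement_defeat (@sc Vt Xt))
  /\
  (* (ii) *)
  (forall f : vccr_fun Vt Xt,
     is_vccr f -> anonymity f -> neutrality f -> availability f ->
     downward_homogeneity f -> neutral_indifference f -> neutral_reversal f ->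
     monotonicity_two f -> coherent_IIA f -> coherent_defeat f ->
     positive_involvement_defeat f ->
     forall P, wf_profile P -> same_rel (f P) (@sc Vt Xt P))
  /\
  (* (iii) *)
  (forall f : vccr_fun Vt Xt,
     is_vccr f -> anonymity f -> neutrality f -> availability f ->
     homogeneity f -> neutral_reversal f ->
     monotonicity_two f -> coherent_IIA f -> coherent_defeat f ->
     positive_involvement_defeat f ->
     forall P, wf_profile P -> same_rel (f P) (@sc Vt Xt P)).
Proof.
split; last split.
- split; first exact: sc_vccr.
  split; first exact: sc_anonymity.
  split; first exact: sc_neutrality.
  split; first exact: sc_availability.
  split; first exact: sc_homogeneity.
  split; first exact: sc_downward_homogeneity.
  split; first exact: sc_neutral_indifference.
  split; first exact: sc_neutral_reversal.
  split; first exact: sc_monotonicity.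
  split; first exact: sc_coherent_IIA.
  split; first exact: sc_coherent_defeat.
  exact: sc_positive_involvement.
- move=> f vf an ne av _ _ nr _ ciia cd pid P wfP x y.
  by split; [exact: sub_sc|exact: sc_sub].
- move=> f vf an ne av _ nr _ ciia cd pid P wfP x y.
  by split; [exact: sub_sc|exact: sc_sub].
Qed.
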